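(* Let $(\mathcal{R},\leq,r)$ be a \textbf{wA2}-space, and let $\pi_0:\mathcal{R}\times2^\omega\to\mathcal{R}$ be the projection onto the first coordinate. If $\mathcal{C}\subseteq\mathcal{R}\times2^\omega$ is Kastanas Ramsey (with respect to the \textbf{wA2}-space $(\mathcal{R}\times2^\omega,\preceq,r)$), then $\pi_0[\mathcal{C}]\subseteq\mathcal{R}$ is Kastanas Ramsey (with respect to $(\mathcal{R},\leq,r)$).
   Context: $\mathcal{R}$ nonempty, $\le$ quasi-order on $\mathcal{R}$, $r:\mathcal{R}\times\omega\to\mathcal{AR}$, $r_n(A):=r(A,n)$, $\mathcal{AR}_n$ the image of $r_n$. A1: (1) $r_0(A)=\emptyset$; (2) $A\ne B\Rightarrow r_n(A)\ne r_n(B)$ for some $n$; (3) $r_n(A)=r_m(B)\Rightarrow n=m$ and $r_k(A)=r_k(B)$ for $k<n$. $\mathrm{lh}(a)$: the $n$ with $a\in\mathcal{AR}_n$; $a\sqsubseteq b$ iff $a=r_m(A)$, $b=r_n(A)$ for some $A$, $m\le n$. wA2: a quasi-order $\leq_{\mathrm{fin}}$ on $\mathcal{AR}$ with (w1) $\{a:a\leq_{\mathrm{fin}}b\}$ countable; (2) $A\le B$ iff $\forall n\exists m\ r_n(A)\leq_{\mathrm{fin}}r_m(B)$; (3) $a\sqsubseteq b\leq_{\mathrm{fin}}c\Rightarrow\exists d\sqsubseteq c\ a\leq_{\mathrm{fin}}d$. $[a,A]=\{B\le A:\exists n\ r_n(B)=a\}$; $[n,A]=[r_n(A),A]$; $\mathrm{depth}_B(a)=\min\{n:a\leq_{\mathrm{fin}}r_n(B)\}$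 or $\infty$; $\mathcal{AR}{\upharpoonright}A=\{a:\exists n\ a\leq_{\mathrm{fin}}r_n(A)\}$; $r_n[a,A]=\{b\in\mathcal{AR}{\upharpoonright}A:a\sqsubseteq b,\mathrm{lh}(b)=n\}$. A3: (1) $\mathrm{depth}_B(a)<\infty\Rightarrow[a,A]\ne\emptyset$ for all $A\in[\mathrm{depth}_B(a),B]$; (2) $A\le B$, $[a,A]\ne\emptyset\Rightarrow\exists A'\in[\mathrm{depth}_B(a),B]$ with $\emptyset\ne[a,A']\subseteq[a,A]$. A \textbf{wA2}-space: A1, wA2, A3 hold and $\mathcal{R}$ (identified with $\{(r_n(A))_n\}$) is closed in $\mathcal{AR}^{\mathbb N}$. The \textbf{wA2}-space $(\mathcal{R}\times2^\omega,\preceq,r)$: approximations $\bigcup_n\mathcal{AR}_n\times2^n$; $r_n(A,u):=(r_n(A),u{\upharpoonright}n)$; $(a,p)\preceq_{\mathrm{fin}}(b,q)$ iff $a\leq_{\mathrm{fin}}b$; $(A,u)\preceq(B,v)$ iff $\forall n\exists m\ r_n(A,u)\preceq_{\mathrm{fin}}r_m(B,v)$. All notions below are applied to this triple in the same way. Kastanas game $K[a,A]$ (in any such space): with $a_0=a$, $B_{-1}=A$, in round $n\ge0$ I plays $A_n\in[a_n,B_{n-1}]$, then II plays $a_{n+1}\in r_{\mathrm{lh}(a_n)+1}[a_n,A_n]$ and $B_n\in[a_{n+1},A_n]$; outcome: the element $B$ with $r_{\mathrm{lh}(a)+n}(B)=a_n$ for all $n$. $\mathcal{X}$ is Kastanas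 Ramsey if for all $A$ and $a\in\mathcal{AR}{\upharpoonright}A$ there is $B\in[a,A]$ such that I has a strategy in $K[a,B]$ ensuring the outcome lies in $\mathcal{X}^c$, or II has a strategy in $K[a,B]$ ensuring the outcome lies in $\mathcal{X}$. *)

(* Defs.v *)
From mathcomp Require Import all_boot.
From mathcomp Require Import all_classical.
From mathcomp Require Import topology.

Set Implicit Arguments.
Unset Strict Implicit.
Unset Printing Implicit Defensive.

Local Open Scope classical_set_scope.

(* The data (R, <=, r) together with the type AR of approximations and the
   relation <=_fin on it; the axioms are collected in [wA2_space]. *)
Record triple := Triple {
  pt : Type;
  appr : Type;
  le : pt -> pt -> Prop;
  lefin : appr -> appr -> Prop;
  r : pt -> nat -> appr }.

Section Notions.
Variable S : triple.
Implicit Types (A B : pt S) (a b c d : appr S) (n m k : nat).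

Definition AR_ n : set (appr S) := [set r A n | A in [set: pt S]].

(* Well defined on the union of the AR_ n as soon as these are disjoint, which
   is part of A1. *)
Definition lh a : nat := xget 0 [set n | AR_ n a].

Definition initseg a b : Prop :=
  exists A m n, [/\ m <= n, a = r A m & b = r A n].

Definition basic a A : set (pt S) := [set B | le B A /\ exists n, r B n = a].

Definition basicn n A : set (pt S) := basic (r A n) A.

(* [None] stands for infinity. *)
Definition depth B a : option nat :=
  match pselect (exists n, `[< lefin a (r B n) >]) with
  | left ex => Some (ex_minn ex)
  | right _ => None
  end.

Definition AR_below A : set (appr S) := [set a | exists n, lefin a (r A n)].

Definition rbasic n a A : set (appr S) :=
  [set b | [/\ AR_below A b, initseg a b & lh b = n]].

Definition axiom_A1 : Prop :=
  [/\ exists e, forall A, r A 0 = e,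
      forall A B, A <> B -> exists n, r A n <> r B n
    & forall A B n m, r A n = r B m ->
        n = m /\ forall k, k < n -> r A k = r B k].

Definition axiom_wA2 : Prop :=
  RelationClasses.PreOrder (@lefin S) /\
  [/\ forall b, countable [set a | lefin a b],
      forall A B, le A B <-> forall n, exists m, lefin (r A n) (r B m)
    & forall a b c, initseg a b -> lefin b c ->
        exists2 d, initseg d c & lefin a d].

Definition axiom_A3 : Prop :=
  (forall a B n, depth B a = Some n ->
     forall A, basicn n B A -> basic a A !=set0) /\
  (forall a A B, le A B -> basic a A !=set0 ->
     exists n A', [/\ depth B a = Some n, basicn n B A',
                      basic a A' !=set0 & basic a A' `<=` basic a A]).

(* AR^N with the product of the discrete topologies. *)
Definition appr_seq : Type :=
  prod_topology (fun _ : nat => discrete_topology {classic appr S}).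

Definition closed_axiom : Prop :=
  closed (range (@r S : pt S -> appr_seq)).

Definition wA2_space : Prop :=
  [/\ [set: pt S] !=set0, RelationClasses.PreOrder (@le S)
    & forall a, exists n, AR_ n a] /\
  [/\ axiom_A1, axiom_wA2, axiom_A3 & closed_axiom].

(* Kastanas game.  Round n of a run is the triple (A_n, (a_{n+1}, B_n)); a run
   need not obey the rules. *)
Definition round : Type := (pt S * (appr S * pt S))%type.
Definition run : Type := nat -> round.

Section Game.
Variables (a : appr S) (A : pt S).
Implicit Type p : run.

Definition moveI p n : pt S := (p n).1.

(* a_n, where a_0 = a *)
Definition posa p n : appr S := if n is m.+1 then (p m).2.1 else a.

(* B_{n-1}, where B_{-1} = A *)
Definition posB p n : pt S := if n is m.+1 then (p m).2.2 else A.

Definition legalI p n : Prop := basic (posa p n) (posB p n) (moveI p n).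

Definition legalII p n : Prop :=
  rbasic (lh (posa p n)).+1 (posa p n) (moveI p n) (posa p n.+1) /\
  basic (posa p n.+1) (moveI p n) (posB p n.+1).

Definition is_outcome p B : Prop := forall n, r B (lh a + n) = posa p n.

(* A strategy maps the finished rounds (for II, also the pending move of I) to
   the next move.  It must obey the rules as long as the opponent does, and
   every run against an opponent who obeys them must reach the goal. *)
Definition followsI (s : seq round -> pt S) p : Prop :=
  forall n, moveI p n = s (mkseq p n).

Definition followsII (s : seq round -> pt S -> appr S * pt S) p : Prop :=
  forall n, (p n).2 = s (mkseq p n) (moveI p n).

Definition winsI (Y : set (pt S)) : Prop :=
  exists s, forall p, followsI s p ->
    (forall n, (forall m, m < n -> legalII p m) -> legalI p n) /\
    ((forall n, legalII p n) -> exists2 B, is_outcome p B & Y B).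

Definition winsII (Y : set (pt S)) : Prop :=
  exists s, forall p, followsII s p ->
    (forall n, (forall m, m <= n -> legalI p m) -> legalII p n) /\
    ((forall n, legalI p n) -> exists2 B, is_outcome p B & Y B).

End Game.

Definition kastanas_ramsey (X : set (pt S)) : Prop :=
  forall A a, AR_below A a ->
    exists2 B, basic a A B & winsI a B (~` X) \/ winsII a B X.

End Notions.

Section CantorProduct.
Variable S : triple.

(* The union over n of AR_n x 2^n; the length of the binary word is n. *)
Definition prod_appr : Type :=
  {x : appr S * seq bool | AR_ (size x.2) x.1}.

Lemma prod_r_subproof (A : pt S) (u : nat -> bool) n :
  AR_ (size (r A n, mkseq u n).2) (r A n, mkseq u n).1.
Proof. by rewrite /= size_mkseq; exists A. Qed.

Definition prod_r (x : pt S * (nat -> bool)) n : prod_appr :=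
  exist _ (r x.1 n, mkseq x.2 n) (prod_r_subproof x.1 x.2 n).

Definition prod_lefin (x y : prod_appr) : Prop :=
  lefin (sval x).1 (sval y).1.

Definition prod_le (x y : pt S * (nat -> bool)) : Prop :=
  forall n, exists m, prod_lefin (prod_r x n) (prod_r y m).

Definition cantor_prod : triple :=
  {| pt := (pt S * (nat -> bool))%type; appr := prod_appr;
     le := prod_le; lefin := prod_lefin; r := prod_r |}.

End CantorProduct.

(* Main.v *)
Require Import Defs.
From mathcomp Require Import all_boot.
From mathcomp Require Import all_classical.

Local Open Scope classical_set_scope.

Set Implicit Arguments.
Unset Strict Implicit.
Unset Printing Implicit Defensive.

(* If II wins the game for C from some (a, w) below A, then II wins for the
   projection by copying that strategy and dropping the binary digits.
   Otherwise I has a winning strategy for the complement of C from every word w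
   of length lh a, and I plays all these games at once: in round n there is one
   simulated game for each of the finitely many words q of length lh a + n.  I
   goes through these words in succession, answering the q-th game as if II had
   just played the answer obtained in the previous one, so that the last answer
   lies below all of them and can be played in the real game.  If the outcome is
   X, then for every u the simulated games along the initial segments of u form
   one run with outcome (X, u), so (X, u) is not in C. *)

(** The part of A1 that makes [lh] well defined; it passes directly to the product. *)
Definition index_determined (S : triple) : Prop :=
  forall (A B : pt S) n m, r A n = r B m -> n = m.

(** * Strategies and finite histories in the Kastanas game *)

Section Games.
Variable S : triple.
Implicit Types (A B : pt S) (a b : appr S) (p q : run S) (Y : set (pt S)).

Lemma eq_mkseq_lt (T : Type) (f g : nat -> T) n :
  (forall m, m < n -> f m = g m) -> mkseq f n = mkseq g n.
Proof.
move=> e; apply/eq_in_map => m; rewrite mem_iota => /andP[_]; exact: e.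
Qed.

Lemma lh_r (hidx : index_determined S) A n : lh (r A n) = n.
Proof.
rewrite /lh; case: xgetP => [m _ [B _] /hidx // | h].
by case: (h n); exists A.
Qed.

Lemma AR_lh (hS : forall a, exists n, AR_ n a) a : AR_ (lh a) a.
Proof. exact: xgetPex (hS a). Qed.

Lemma basic_lh (hidx : index_determined S) a A B :
  basic a A B -> r B (lh a) = a.
Proof. by case=> _ [n <-]; rewrite lh_r. Qed.

Lemma eq_posa a p q n :
  (forall m, m < n -> p m = q m) -> posa a p n = posa a q n.
Proof. by case: n => //= n e; rewrite e. Qed.

Lemma eq_posB A p q n :
  (forall m, m < n -> p m = q m) -> posB A p n = posB A q n.
Proof. by case: n => //= n e; rewrite e. Qed.

Lemma eq_legalII a A p q n :
  (forall m, m <= n -> p m = q m) -> legalII a A p n -> legalII a A q n.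
Proof.
move=> e; rewrite /legalII /moveI -(eq_posa a (p := p)) => [|m /ltnW /e //].
by rewrite /= -e.
Qed.

Lemma lh_posa a A p n : (forall m, m < n -> legalII a A p m) ->
  lh (posa a p n) = lh a + n.
Proof.
elim: n => [|n IH] L; first by rewrite addn0.
have [[_ _ ->] _] := L n (ltnSn n).
by rewrite IH ?addnS // => m mn; apply: L; apply: ltnW.
Qed.

(** Turns a function of whole runs that reads only earlier rounds into a strategy: the finite
    history is padded with a dummy round. *)
Lemma winsI_causal a A Y (F : run S -> nat -> pt S) :
  (forall p q n, (forall m, m < n -> p m = q m) -> F p n = F q n) ->
  (forall p, (forall n, moveI p n = F p n) ->
    (forall n, (forall m, m < n -> legalII a A p m) -> legalI a A p n) /\
    ((forall n, legalII a A p n) -> exists2 B, is_outcome a p B & Y B)) ->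
  winsI a A Y.
Proof.
move=> Fc win; exists (fun h => F (nth (A, (a, A)) h) (size h)) => p fp.
apply: win => n; rewrite fp size_mkseq.
by apply: Fc => m mn; rewrite nth_mkseq.
Qed.

Lemma winsII_causal a A Y (F : run S -> nat -> pt S -> appr S * pt S) :
  (forall p q n, (forall m, m < n -> p m = q m) -> F p n = F q n) ->
  (forall p, (forall n, (p n).2 = F p n (moveI p n)) ->
    (forall n, (forall m, m <= n -> legalI a A p m) -> legalII a A p n) /\
    ((forall n, legalI a A p n) -> exists2 B, is_outcome a p B & Y B)) ->
  winsII a A Y.
Proof.
move=> Fc win; exists (fun h => F (nth (A, (a, A)) h) (size h)) => p fp.
apply: win => n; rewrite fp size_mkseq.
by rewrite (Fc _ p) // => m mn; rewrite nth_mkseq.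
Qed.

Lemma followsI_run (s : seq (round S) -> pt S) (t : nat -> appr S * pt S) :
  exists2 p, followsI s p & forall n, (p n).2 = t n.
Proof.
pose H := fix H n := if n is m.+1 then rcons (H m) (s (H m), t m) else [::].
exists (fun n => (s (H n), t n)) => // n; rewrite /moveI /=; congr s.
by elim: n => // n IH; rewrite mkseqS -IH.
Qed.

Definition winning_for_I a A Y (s : seq (round S) -> pt S) : Prop :=
  forall p, followsI s p ->
    (forall n, (forall m, m < n -> legalII a A p m) -> legalI a A p n) /\
    ((forall n, legalII a A p n) -> exists2 B, is_outcome a p B & Y B).

(* The run need only follow [s] up to round [n]; beyond it is replaced by one
   that keeps following [s]. *)
Lemma winning_move a A Y (s : seq (round S) -> pt S) :
  winning_for_I a A Y s ->
  forall p n, (forall m, m <= n -> moveI p m = s (mkseq p m)) ->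
    (forall m, m < n -> legalII a A p m) -> legalI a A p n.
Proof.
move=> win p n fp Lp.
have [q fq eq2] := followsI_run s (fun m => (p m).2).
have epq : forall m, m <= n -> p m = q m.
  elim/ltn_ind => m IH mn.
  have e : mkseq p m = mkseq q m.
    apply: eq_mkseq_lt => k km; apply: IH => //; apply: ltnW.
    exact: leq_trans mn.
  have e1 : (p m).1 = (q m).1 by have := fp m mn; rewrite e -fq.
  by move: e1 (eq2 m); case: (p m) (q m) => [? ?] [? ?] /= -> ->.
have := (win q fq).1 n; rewrite /legalI /moveI -epq //.
rewrite -(eq_posa a (p := p)); last by move=> m /ltnW; apply: epq.
rewrite -(eq_posB A (p := p)); last by move=> m /ltnW; apply: epq.
apply=> m mn; apply: eq_legalII (Lp m mn) => k km.
by apply: epq; apply: leq_trans km (ltnW mn).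
Qed.

End Games.

(** * Passing a point through a finite list of maps *)

Section Thread.
Variables (W : eqType) (X : Type) (f : W -> X -> X).

Definition thread c (ws : seq W) : X := foldl (fun c w => f w c) c ws.

Definition before c ws w : X := thread c (take (index w ws) ws).

Variables (R : X -> X -> Prop) (P : X -> Prop).
Hypothesis (Rrefl : forall x, R x x).
Hypothesis (Rtrans : forall x y z, R x y -> R y z -> R x z).

(** Each map lowers the current value along [R], so the last value stays below the answer given at
    every word; [P] is the invariant under which the maps may be applied. *)
Lemma threadP c ws : P c ->
  (forall w d, w \in ws -> P d -> R (f w d) d /\ P (f w d)) ->
  [/\ P (thread c ws), R (thread c ws) c &
    forall w, w \in ws ->
      P (before c ws w) /\ R (thread c ws) (f w (before c ws w))].
Proof.
elim: ws c => [|w ws IH] c Pc step; first by split.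
have [Rw Pw] := step w c (mem_head _ _) Pc.
have [||Pt Rt ft] := IH (f w c) => // [v d vin|].
  by apply: step; rewrite inE vin orbT.
split=> //= [|v]; first exact: Rtrans Rw.
rewrite inE /before /= eq_sym; have [<- _|ne /= vin] := eqVneq; first by [].
by have [] := ft v vin; rewrite /before /thread.
Qed.

End Thread.

(** * Binary words and initial segments of sequences *)

Definition words k : seq (seq bool) := [seq val t | t <- enum {:k.-tuple bool}].

Lemma mem_words k w : (w \in words k) = (size w == k).
Proof.
apply/mapP/eqP => [[t _ ->]|<-]; first exact: size_tuple.
by exists (in_tuple w); rewrite ?mem_enum.
Qed.

Lemma mkseq_in_words (u : nat -> bool) n : mkseq u n \in words n.
Proof. by rewrite mem_words size_mkseq. Qed.

Lemma mkseq_inj (T : Type) (u v : nat -> T) N :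
  (forall n, mkseq u (N + n) = mkseq v (N + n)) -> u = v.
Proof.
move=> e; apply: funext => n; have := e n.+1.
move/(congr1 (fun s => nth (u n) s n)).
by rewrite !nth_mkseq // addnS ltnS leq_addl.
Qed.

Lemma take_mkseq_le (T : Type) (u : nat -> T) n m :
  n <= m -> take n (mkseq u m) = mkseq u n.
Proof. by move=> nm; rewrite /mkseq -map_take take_iota (minn_idPl nm). Qed.

(** * The product with Cantor space, and projection of strategies of II *)

Section Product.
Variable S : triple.
Hypothesis hidx : index_determined S.
Local Notation T := (cantor_prod S).
Implicit Types (x y : appr T) (U V : pt T).

Lemma prod_appr_inj x y : sval x = sval y -> x = y.
Proof. by case: x y => [x hx] [y hy] /= e; apply: eq_exist. Qed.

Lemma prod_rP U V n : r U.1 n = r V.1 n -> mkseq U.2 n = mkseq V.2 n ->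
  prod_r U n = prod_r V n.
Proof. by move=> e1 e2; apply: prod_appr_inj; rewrite /= e1 e2. Qed.

Lemma prod_index_determined : index_determined T.
Proof. by move=> U V n m /(congr1 sval) [/hidx]. Qed.

Lemma prod_apprE x : exists V, x = prod_r V (size (sval x).2).
Proof.
case: x => [[a w] h]; have [A _ e] := h; exists (A, nth false w).
by apply: prod_appr_inj; rewrite /= e mkseq_nth.
Qed.

Lemma lh_prod x : lh x = lh (sval x).1.
Proof.
by have [V ->] := prod_apprE x; rewrite (lh_r prod_index_determined) /= lh_r.
Qed.

Lemma initseg_proj x y : initseg x y -> initseg (sval x).1 (sval y).1.
Proof. by move=> [V [m [n [mn -> ->]]]]; exists V.1, m, n. Qed.

Lemma rbasic_proj n x V y :
  rbasic n x V y -> rbasic n (sval x).1 V.1 (sval y).1.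
Proof.
by move=> [[m ?] /initseg_proj ? <-]; split; [exists m| |rewrite lh_prod].
Qed.

Hypothesis leE : forall A B : pt S,
  le A B <-> forall n, exists m, lefin (r A n) (r B m).

(** [prod_lefin] ignores the binary word, so the order does not see the second coordinate. *)
Lemma prod_leE U V : le U V <-> le U.1 V.1.
Proof. exact: iff_sym (leE _ _). Qed.

Lemma basic_proj x U V : basic x U V -> basic (sval x).1 U.1 V.1.
Proof. by move=> [/prod_leE ? [n <-]]; split=> //; exists n. Qed.

Lemma winsII_proj x V (Y : set (pt T)) :
  (exists n, prod_r V n = x) -> winsII x V Y ->
  winsII (sval x).1 V.1 [set U.1 | U in Y].
Proof.
move=> hx [s win].
(* A move of I is lifted with the second coordinate of the last point played by II (of [V] at the
   start), so that it keeps the current binary word. *)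
pose R h A : round T :=
  let U := (A, (last V [seq rd.2.2 | rd <- h]).2) in (U, s h U).
pose H (p : run S) :=
  fix H n := if n is m.+1 then rcons (H m) (R (H m) (p m).1) else [::].
apply: (@winsII_causal _ _ _ _
  (fun p n A => let z := (R (H p n) A).2 in ((sval z.1).1, z.2.1))).
  move=> p q n e; suff -> : H p n = H q n by [].
  elim: n e => //= n IH e; rewrite e // IH // => m mn.
  by apply: e; apply: ltnW.
move=> p fp; pose P n := R (H p n) (p n).1.
have HP n : H p n = mkseq P n by elim: n => // n IH; rewrite mkseqS -IH.
have fP : followsII s P by move=> n; rewrite /moveI -HP.
have lastE n : last V [seq rd.2.2 | rd <- H p n] = posB V P n.
  by case: n => //= n; rewrite map_rcons last_rcons.
have [legP outP] := win P fP.
have posaE n : posa (sval x).1 p n = (sval (posa x P n)).1.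
  by case: n => //= n; rewrite fp.
have posBE n : posB V.1 p n = (posB V P n).1.
  by case: n => //= n; rewrite fp.
(* Lifting a legal move legally requires that the last point of II has the current position as an
   approximation, so both facts are carried together; [hx] starts the induction. *)
have main n : (forall m, m < n -> legalI (sval x).1 V.1 p m) ->
    (exists k, prod_r (posB V P n) k = posa x P n) /\
    forall m, m < n -> legalI x V P m.
  elim: n => [|n IH] L; first by split.
  have [|[k ek] LP] := IH; first by move=> m mn; apply: L; apply: ltnW.
  have LPn : legalI x V P n.
    have [] := L n (ltnSn n); rewrite posaE posBE => le1 [k' ek'].
    split; first exact/prod_leE.
    exists k; rewrite -ek; apply: prod_rP; last by rewrite /= lastE.
    by move: ek'; rewrite -ek /= => ek'; rewrite -{1}(hidx ek').
  have LP' m : m < n.+1 -> legalI x V P m.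
    by rewrite ltnS leq_eqVlt => /orP[/eqP->|/LP].
  by split=> //; have [_ []] := legP n LP'.
have legI n : (forall m, m <= n -> legalI (sval x).1 V.1 p m) ->
    forall m, m <= n -> legalI x V P m.
  by move=> L; have [] := main n.+1 L.
split=> [n L|L].
  have [/rbasic_proj L1 /basic_proj L2] := legP n (legI n L).
  by rewrite /legalII !posaE posBE -lh_prod; split.
have [|U oU YU] := outP; first by move=> n; apply: legI (leqnn n).
exists U.1; last by exists U.
by move=> n; rewrite posaE -lh_prod -oU.
Qed.

End Product.

(** * A strategy of I in the projected game from games over all binary words *)

Section WinsI.
Variable S : triple.
Hypothesis hS : wA2_space S.
Local Notation T := (cantor_prod S).

Let hidx : index_determined S.
Proof. by case: hS => _ [[_ _ h] _ _ _] A B n m /h[]. Qed.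

Let leE (A B : pt S) : le A B <-> forall n, exists m, lefin (r A n) (r B m).
Proof. by case: hS => _ [_ [_ [_ h _]] _ _]; apply: h. Qed.

Lemma wA2_le_refl (A : pt S) : le A A.
Proof. by case: hS => [[_ [h _] _] _]; apply: h. Qed.

Lemma wA2_le_trans (A B D : pt S) : le A B -> le B D -> le A D.
Proof. by case: hS => [[_ [_ h] _] _]; apply: h. Qed.

Lemma AR_below_le (A B : pt S) b : le A B -> AR_below A b -> AR_below B b.
Proof.
case: hS => _ [_ [[_ tr] _] _ _] /leE AB [n bn].
by have [m nm] := AB n; exists m; apply: tr nm.
Qed.

Lemma AR_below_r (A : pt S) n : AR_below A (r A n).
Proof. by case: hS => _ [_ [[rf _] _] _ _]; exists n; apply: rf. Qed.

Lemma initseg_r (a b : appr S) (A : pt S) :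
  initseg a b -> r A (lh b) = b -> r A (lh a) = a.
Proof.
case: hS => _ [[_ _ h] _ _ _] [B [m [n [mn -> ->]]]].
rewrite !lh_r // => e; move: mn; rewrite leq_eqVlt => /orP[/eqP->//|mn].
by have [_] := h _ _ _ _ e; apply.
Qed.

Lemma pt_inj (A B : pt S) N : (forall n, r A (N + n) = r B (N + n)) -> A = B.
Proof.
case: hS => _ [[_ ext h] _ _ _] e; apply: contrapT => /ext[n]; apply.
by have [_] := h _ _ _ _ (e n.+1); apply; rewrite addnS ltnS leq_addl.
Qed.

Variables (a : appr S) (A0 : pt S).
Hypothesis A0a : r A0 (lh a) = a.
Let N := lh a.

Definition start (w : seq bool) : appr T := prod_r (A0, nth false w) N.

Variables (C : set (pt T)) (V : seq bool -> pt T).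
Variable s : seq bool -> seq (round T) -> pt T.
Hypothesis win : forall w, w \in words N ->
  winning_for_I (start w) (V w) (~` C) (s w).

(* If [D] extends the real [a_n] and [q] has length [lh a_n], then
   [prod_r (D, _) (size q)] is the pair of [a_n] and [q]; naming it this way
   makes the move total. *)
Definition imove (D : pt S) (q : seq bool) : appr T * pt T :=
  let U := (D, nth false q) in (prod_r U (size q), U).

Lemma sval_start w : w \in words N -> sval (start w) = (a, w).
Proof. by rewrite mem_words /= A0a => /eqP<-; rewrite mkseq_nth. Qed.

(** Dropping the last letter of [q] gives the word of the previous round; its first [N] letters tell
    which game, hence which strategy, is used. *)
Definition extend (G : seq bool -> seq (round T)) (D : pt S) q :=
  let h := G (take (size q).-1 q) in rcons h (s (take N q) h, imove D q).

Definition response G q (D : pt S) : pt S := (s (take N q) (extend G D q)).1.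

(* [history p n q] is the simulated run belonging to the word [q] of length
   [lh a + n]. *)
Fixpoint history (p : run S) n : seq bool -> seq (round T) :=
  if n is m.+1 then
    fun q => let G := history p m in
      extend G (before (response G) (p m).2.2 (words (N + n)) q) q
  else fun=> [::].

Definition branch (p : run S) (u : nat -> bool) n : round T :=
  (s (mkseq u N) (history p n (mkseq u (N + n))),
   imove (before (response (history p n)) (p n).2.2 (words (N + n.+1))
            (mkseq u (N + n.+1))) (mkseq u (N + n.+1))).

(** The histories along the initial segments of [u] cohere: each adds one round to the previous
    one. *)
Lemma historyE p u n : history p n (mkseq u (N + n)) = mkseq (branch p u) n.
Proof.
elim: n => // n IH; rewrite mkseqS -IH /= /extend size_mkseq.
have -> : (N + n.+1).-1 = N + n by rewrite addnS.
by rewrite !take_mkseq_le ?leq_add2l ?leq_addr.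
Qed.

Lemma branch_follows p u : followsI (s (mkseq u N)) (branch p u).
Proof. by move=> n; rewrite -historyE. Qed.

Definition reply (B0 : pt S) (p : run S) n : pt S :=
  if n is m.+1 then thread (response (history p m)) (p m).2.2 (words (N + n))
  else B0.

Lemma eq_history p q n : (forall m, m < n -> p m = q m) ->
  history p n = history q n.
Proof.
elim: n => //= n IH e; rewrite e // IH // => m mn.
by apply: e; apply: ltnW.
Qed.

(** The last clause is what makes the answers of II in the real game legal in the simulated one. *)
Definition simulates (p : run S) n (u : nat -> bool) : Prop :=
  let w := mkseq u N in
  [/\ forall m, m < n -> legalII (start w) (V w) (branch p u) m,
      sval (posa (start w) (branch p u) n) = (posa a p n, mkseq u (N + n)) &
      le (moveI p n) (moveI (branch p u) n).1].

(* Stated for an arbitrary [D] rather than for the move actually used by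
   [branch], since that move is only known to be good after going through the
   preceding words. *)
Lemma simulated_legalII B0 p n u D :
  simulates p n u -> (forall m, m < n.+1 -> legalII a B0 p m) ->
  basic (posa a p n.+1) (moveI p n) D ->
  let w := mkseq u N in
  let x := posa (start w) (branch p u) n in
  let q := mkseq u (N + n.+1) in
  rbasic (lh x).+1 x (moveI (branch p u) n) (imove D q).1 /\
  basic (imove D q).1 (moveI (branch p u) n) (imove D q).2.
Proof.
move=> [Lu xE Mle] L bD w x q.
have lq : size q = N + n.+1 by rewrite size_mkseq.
have la : lh (posa a p n) = N + n.
  by apply: lh_posa => m mn; apply: L; apply: ltnW.
have la' : lh (posa a p n.+1) = N + n.+1 by apply: lh_posa L.
have Da' : r D (lh (posa a p n.+1)) = posa a p n.+1 by apply: basic_lh bD.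
have [[Mb ini _] _] := L n (ltnSn n).
have Da := initseg_r ini Da'.
rewrite la in Da; rewrite la' in Da'.
split; last first.
  split; last by exists (size q).
  by apply/prod_leE => //=; apply: wA2_le_trans Mle; case: bD.
split.
- have [m] := AR_below_le Mle Mb.
  by exists m; rewrite /= /prod_lefin /= lq Da'.
- exists (D, nth false q), (N + n), (size q); split=> //.
    by rewrite lq leq_add2l.
  apply: prod_appr_inj; rewrite [LHS]xE /= Da; congr pair.
  apply: eq_mkseq_lt => k kn.
  by rewrite nth_mkseq // addnS ltnS; apply: ltnW.
- rewrite (lh_r (prod_index_determined hidx)) lh_prod // xE /= la lq.
  by rewrite addnS.
Qed.

Lemma response_basic B0 p n q D :
  (forall u, simulates p n u) -> (forall m, m < n.+1 -> legalII a B0 p m) ->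
  q \in words (N + n.+1) -> basic (posa a p n.+1) (moveI p n) D ->
  basic (posa a p n.+1) D (response (history p n) q D).
Proof.
rewrite mem_words => sim L /eqP lq bD.
pose u := nth false q; pose w := mkseq u N.
have uq : mkseq u (N + n.+1) = q by rewrite -lq mkseq_nth.
have [Lu xE Mle] := sim u.
have := simulated_legalII (sim u) L bD; rewrite /= uq => Ln.
have wq : take N q = w by rewrite -uq take_mkseq_le // leq_addr.
have Gq : take (size q).-1 q = mkseq u (N + n).
  by rewrite lq -uq addnS take_mkseq_le.
(* The simulated run with [D] played by II in round [n], followed by the answer of [s];
   [winning_move] at [n.+1] then shows this answer legal. *)
pose P' m : round T :=
  if m < n then branch p u m else
  if m == n then ((branch p u n).1, imove D q) else
  (s w (extend (history p n) D q), imove D q).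
have Plt m : m < n -> branch p u m = P' m by rewrite /P' => ->.
have Pn : P' n = ((branch p u n).1, imove D q) by rewrite /P' ltnn eqxx.
have PS : P' n.+1 = (s w (extend (history p n) D q), imove D q).
  by rewrite /P' ltnNge leqnSn /= gtn_eqF.
have mP m : m <= n -> mkseq P' m = mkseq (branch p u) m.
  move=> mn; apply: eq_mkseq_lt => k km; rewrite -Plt //.
  exact: leq_trans mn.
have fP m : m <= n.+1 -> moveI P' m = s w (mkseq P' m).
  rewrite leq_eqVlt => /orP[/eqP->|].
    rewrite /moveI PS mkseqS Pn mP // -historyE; congr s.
    by rewrite /extend Gq wq.
  rewrite ltnS => mn; rewrite mP // -branch_follows /moveI.
  by move: mn; rewrite leq_eqVlt => /orP[/eqP->|/Plt->//]; rewrite Pn.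
have LP m : m < n.+1 -> legalII (start w) (V w) P' m.
  rewrite ltnS leq_eqVlt => /orP[/eqP->|mn]; last first.
    apply: eq_legalII (Lu m mn) => k km; apply: Plt.
    exact: leq_ltn_trans mn.
  by rewrite /legalII /moveI /= Pn -(eq_posa _ (p := branch p u)).
have := winning_move (win (mkseq_in_words u N)) fP LP.
rewrite /legalI /moveI PS /= Pn /= => /(basic_proj leE) /=.
have := basic_lh hidx bD; rewrite (lh_posa L) => e.
by rewrite lq e /response wq.
Qed.

Variable B0 : pt S.
Hypothesis B0a : r B0 N = a.
Hypothesis B0s : forall w, w \in words N -> le B0 (s w [::]).1.

(** Simulation up to round [n] makes every response legal while the words are threaded; the last
    response lies below all of them, which restores the simulation at [n.+1]. *)
Lemma reply_legal p n : (forall n, moveI p n = reply B0 p n) ->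
  (forall m, m < n -> legalII a B0 p m) ->
  legalI a B0 p n /\ forall u, simulates p n u.
Proof.
move=> fp; elim: n => [_|n IH L].
  split; first by rewrite /legalI fp; split; [exact: wA2_le_refl | exists N].
  move=> u; split=> //=.
    by rewrite addn0 -(sval_start (mkseq_in_words u N)).
  by rewrite fp; apply: B0s; apply: mkseq_in_words.
have [|_ sim] := IH; first by move=> m mn; apply: L; apply: ltnW.
have [_ bB] := L n (ltnSn n).
have [|bM leM sM] := @threadP _ _ (response (history p n)) (@le S)
    (basic (posa a p n.+1) (moveI p n)) wA2_le_refl wA2_le_trans
    (p n).2.2 (words (N + n.+1)) bB.
  move=> q D qin bD; have [leD rD] := response_basic sim L qin bD.
  by split=> //; split=> //; apply: wA2_le_trans leD _; case: bD.
have eM : moveI p n.+1 = _ := fp n.+1.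
split; first by rewrite /legalI eM; split=> //; case: bM.
move=> u; have [bq leq] := sM _ (mkseq_in_words u (N + n.+1)).
have [Lu xE Mle] := sim u.
split.
- move=> m; rewrite ltnS leq_eqVlt => /orP[/eqP->|]; last exact: Lu.
  exact: simulated_legalII (sim u) L bq.
- rewrite [posa _ (branch p u) _]/= /= size_mkseq.
  have := basic_lh hidx bq; rewrite (lh_posa L) => ->.
  by rewrite -{2}(size_mkseq u (N + n.+1)) mkseq_nth.
- rewrite eM branch_follows -historyE.
  apply: wA2_le_trans leq _; rewrite /response /= take_mkseq_le ?leq_addr //.
  exact: wA2_le_refl.
Qed.

Lemma winsI_proj : winsI a B0 (~` [set U.1 | U in C]).
Proof.
apply: (@winsI_causal _ _ _ _ (reply B0)).
  by move=> p q [//|n] e /=; rewrite e // (@eq_history p q) // => m /ltnW/e.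
move=> p fp; split=> [n L|L]; first by have [] := reply_legal fp L.
have sim n u : simulates p n u.
  by have [] := @reply_legal p n fp (fun m _ => L m).
have out u : exists2 U, ~ C U &
    forall n, r U.1 (N + n) = posa a p n /\ U.2 = u.
  have [|U oU nCU] := (win (mkseq_in_words u N) (branch_follows p u)).2.
    by move=> n; have [+ _ _] := sim n.+1 u; apply.
  exists U => // n.
  have UE k : sval (prod_r U (N + k)) = (posa a p k, mkseq u (N + k)).
    have [_ <- _] := sim k u; rewrite -oU; congr (sval (prod_r U (_ + _))).
    by rewrite (lh_r (prod_index_determined hidx)).
  split; first by have [] := UE n.
  by apply: (@mkseq_inj _ _ _ N) => k; have [] := UE k.
have [U nCU UE] := out (fun=> false).
exists U.1; first by move=> n; have [] := UE n.
(* If the real outcome were the projection of [U'] in [C], the branch along [U'.2] would have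
   outcome [U'], which its strategy keeps out of [C]. *)
move=> [U' CU' eU]; have [U2 nCU2 U2E] := out U'.2.
apply: nCU2; suff -> : U2 = U' by [].
have e1 : U2.1 = U'.1.
  by rewrite eU; apply: (@pt_inj _ _ N) => n; rewrite (U2E n).1 (UE n).1.
have := (U2E 0).2.
by move: e1; case: (U2) => x y; case: (U') => x' y' /= -> ->.
Qed.

End WinsI.

(** * Choice of the starting point and of the winner *)

Theorem theorem4p4 (S : triple) (hS : wA2_space S)
    (C : set (pt S * (nat -> bool))) :
  @kastanas_ramsey (cantor_prod S) C ->
  @kastanas_ramsey S [set x.1 | x in C].
Proof.
move=> KR A a Aa.
have [[_ _ hcov] [[_ _ h] [_ [_ leE _]] _ _]] := hS.
have hidx : index_determined S by move=> X Y n m /h[].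
have [A0 _ A0a] := AR_lh hcov a.
pose N := lh a.
pose z (D : pt S) : pt (cantor_prod S) := (D, fun=> false).
have [[w [D [U [wN leD bU wU]]]]|nII] := pselect (exists w D U,
    [/\ w \in words N, le D A, basic (start a A0 w) (z D) U &
        winsII (start a A0 w) U C]).
  exists U.1.
    have [leU eU] := basic_proj leE bU.
    split; first exact: wA2_le_trans leU leD.
    by move: eU; rewrite /= A0a.
  right; rewrite -A0a; apply: (winsII_proj hidx leE _ wU).
  by have [_] := bU.
(* Stated as an implication so that choice gives a total function; outside the hypotheses a dummy
   value is used. *)
pose good (y : seq bool * pt S) (g : pt (cantor_prod S) * _) :=
  y.1 \in words N -> le y.2 A /\ AR_below y.2 a ->
  basic (start a A0 y.1) (z y.2) g.1 /\
  winning_for_I (start a A0 y.1) g.1 (~` C) g.2.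
have [g gP] : {g & forall y, good y (g y)}.
  apply: choice => -[w D].
  have [[wN [leD aD]]|ngood] :=
    pselect (w \in words N /\ le D A /\ AR_below D a);
    last by exists (z A, fun=> z A) => wN aD; case: ngood.
  have [|U bU] := KR (z D) (start a A0 w).
    by have [n an] := aD; exists n; rewrite /= /prod_lefin /= A0a.
  case=> [[s win]|wU]; first by exists (U, s).
  by case: nII; exists w, D, U.
(* The first coordinate of the opening move of I in the game for [w] chosen below [D]. *)
pose f w D := ((g (w, D)).2 [::]).1.
pose P D := le D A /\ AR_below D a.
(* [A] need not begin with [a], but every value of [f] does; the second clause carries this down to
   the end of the thread. *)
pose R D D' := le D D' /\ (r D' N = a -> r D N = a).
have fP w D : w \in words N -> P D -> le (f w D) D /\ r (f w D) N = a.
  move=> wN PD; have [bU win] := gP (w, D) wN PD.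
  have [p fp _] := followsI_run (g (w, D)).2 (fun=> (start a A0 w, z A)).
  have [//|] := (win p fp).1 0; rewrite fp => leU [n en].
  move/(prod_leE leE): leU => leU.
  have [leD _] := basic_proj leE bU.
  split; first exact: wA2_le_trans leU leD.
  have nN : n = N by apply: (prod_index_determined hidx) en.
  by move: en; rewrite nN => /(congr1 sval)[]; rewrite A0a.
have Rrefl D : R D D by split=> //; apply: wA2_le_refl.
have Rtrans D1 D2 D3 : R D1 D2 -> R D2 D3 -> R D1 D3.
  by move=> [l1 e1] [l2 e2]; split=> [|/e2/e1 //]; apply: wA2_le_trans l1 l2.
have [| |PB _ Bf] := @threadP _ _ f R P Rrefl Rtrans A (words N).
- by split=> //; apply: wA2_le_refl.
- move=> w D wN PD; have [lef ef] := fP w D wN PD; split; first by split.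
  split; first by apply: wA2_le_trans lef PD.1.
  by rewrite -ef; apply: AR_below_r.
set B := thread f A (words N) in PB Bf *.
have Ba : r B N = a.
  (* Some word of length [N] is needed here, to place [B] below a value of [f]. *)
  have [P0 [_ ]] := Bf _ (mkseq_in_words (fun=> false) N); apply.
  by have [] := fP _ _ (mkseq_in_words (fun=> false) N) P0.
exists B; first by split; [exact: PB.1 | exists N].
left; pose y w := (w, before f A (words N) w).
apply: (@winsI_proj _ hS a A0 A0a C (fun w => (g (y w)).1)
  (fun w => (g (y w)).2)) => // w wN.
  by have [Pw _] := Bf w wN; have [] := gP (y w) wN Pw.
by have [_ []] := Bf w wN.
Qed.
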